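(* Let $\mathcal{A}$ be a finite alphabet and let $\mathcal{P}\subseteq\mathcal{A}^{\mathbb{N}}$. The following are equivalent. (1) $\mathcal{P}$ is a path set on the alphabet $\mathcal{A}$. (2) $\mathcal{P}$ is a closed subset of $\mathcal{A}^{\mathbb{N}}$ (product topology), and there is a finite collection $\mathcal{S}_0$ of subsets of $\mathcal{A}^{\mathbb{N}}$ which contains $\mathcal{P}$ as a member and which is closed under the operations: (a) apply the one-sided shift, i.e. $X\in\mathcal{S}_0$ implies $\sigma(X)\in\mathcal{S}_0$; (b) intersect with a prefix set, i.e. $X\in\mathcal{S}_0$ implies $X\cap\mathcal{Z}_j\in\mathcal{S}_0$ for every $j\in\mathcal{A}$.
   Context: $\mathcal{A}^{\mathbb{N}}$ is the set of one-sided infinite sequences $a_0a_1a_2\cdots$ with $a_i\in\mathcal{A}$, and $\sigma(a_0a_1a_2\cdots)=a_1a_2a_3\cdots$ is the one-sided shift; $\sigma(X)$ is the image of $X$. For $j\in\mathcal{A}$ the prefix set $\mathcal{Z}_j=j\mathcal{A}^{\mathbb{N}}$ is the set of all sequences in $\mathcal{A}^{\mathbb{N}}$ with initial symbol $a_0=j$. A labeled directed graph over $\mathcal{A}$ is a finite directed graph $\mathcal{G}$ whose edges carry labels from $\mathcal{A}$; loops and multiple edges are allowed, but the triples (initial vertex, terminal vertex, label) are required to be distinct. A pointed graph $(\mathcal{G},v)$ is such a graph with a distinguished vertex $v$. The path set $X_{\mathcal{G}}(v)\subseteq\mathcal{A}^{\mathbb{N}}$ is the set of all sequences of successive edge labels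 of one-sided infinite walks in $\mathcal{G}$ starting at $v$ (it is empty if there are no such walks). A subset of $\mathcal{A}^{\mathbb{N}}$ is a path set if it equals $X_{\mathcal{G}}(v)$ for some pointed graph $(\mathcal{G},v)$ over $\mathcal{A}$. *)

(* Defs.v *)
From HB Require Import structures.
From mathcomp Require Import all_boot.
From mathcomp Require Import boolp classical_sets functions cardinality topology.

Set Implicit Arguments.
Unset Strict Implicit.
Unset Printing Implicit Defensive.

Local Open Scope classical_set_scope.

Definition full_shift (A : finType) : Type :=
  prod_topology (fun _ : nat => discrete_topology A).

HB.instance Definition _ (A : finType) := Topological.on (full_shift A).

Definition shift (A : finType) (a : full_shift A) : full_shift A :=
  fun n => a n.+1.

Definition prefix_set (A : finType) (j : A) : set (full_shift A) :=
  [set a | a 0 = j].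

(* Vertices and edges are independent types, so that loops and multiple edges
   are allowed. *)
Record labeled_graph (A : finType) := LabeledGraph {
  vertex : finType;
  edge : finType;
  source : edge -> vertex;
  target : edge -> vertex;
  label : edge -> A;
  edge_inj : injective (fun e => (source e, target e, label e)) }.

Definition infinite_walk (A : finType) (G : labeled_graph A) (v : vertex G)
    (w : nat -> edge G) : Prop :=
  source (w 0) = v /\ forall n, target (w n) = source (w n.+1).

Definition path_set_of (A : finType) (G : labeled_graph A) (v : vertex G) :
    set (full_shift A) :=
  [set a | exists2 w, infinite_walk v w & forall n, a n = label (w n)].

Definition is_path_set (A : finType) (P : set (full_shift A)) : Prop :=
  exists (G : labeled_graph A) (v : vertex G), P = path_set_of v.

(* Main.v *)
(** If [P] is presented by [(G, v)], the label sets of walks whose first edge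
    lies in a given set of edges form a finite family with the closure
    properties, and [P] is closed by König's lemma.

    Conversely, let the members of [S0] be the vertices, with an edge
    [X --j--> shift (X ∩ Z_j)] whenever the target is nonempty.  Reading
    [a_0 ... a_(n-1)] from [P] leads to the set of tails of the points of [P]
    starting with [a_0 ... a_(n-1)]; hence an
    infinite walk labeled [a] says exactly that every prefix of [a] is a prefix
    of a point of [P], i.e. that [a] is in the closure of [P]. *)

Require Import Defs.
From mathcomp Require Import all_boot.
From mathcomp Require Import boolp classical_sets functions cardinality topology.

Local Open Scope classical_set_scope.

(** The product topology is the supremum of the topologies pulled back along the coordinates, and
    coordinate [i] of [b m] is constant from [m = i + 1] on. *)
Lemma full_shift_cvg {A : finType} (b : nat -> full_shift A) (a : full_shift A) :
  (forall m i, i < m -> b m i = a i) -> b @ \oo --> a.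
Proof.
move=> ba; apply/cvg_sup => i U /=.
rewrite (@nbhsE (initial_topology (@^~ i))) => -[B [[V _ VB] Ba] BU].
exists i.+1 => // m /= im; apply: BU; move: Ba.
by rewrite -VB /= ba.
Qed.

Lemma nbhs_cylinder {A : finType} (a : full_shift A) (m : nat) :
  nbhs a [set b : full_shift A | forall i, i < m -> b i = a i].
Proof.
elim: m => [|m IH]; first by apply: filterS filterT => b.
have am : nbhs a [set b : full_shift A | b m = a m].
  apply: (@proj_continuous nat (fun=> discrete_topology A) m a [set a m]).
  exact: discrete_set1.
apply: filterS2 IH am => b bi bm i; rewrite ltnS leq_eqVlt => /predU1P[->//|].
exact: bi.
Qed.

(** Cylinders are neighborhoods, and points of [P] chosen in ever smaller cylinders around [a]
    converge to [a]. *)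
Lemma closed_cylinderP {A : finType} (P : set (full_shift A)) :
  closed P <->
  forall a : full_shift A,
    (forall m, exists2 b, P b & forall i, i < m -> b i = a i) -> P a.
Proof.
split=> [clP a aP|Pcyl a Pa]; last first.
  by apply: Pcyl => m; have [b [Pb ba]] := Pa _ (nbhs_cylinder a m); exists b.
have /choice[b bP] m : exists b, P b /\ forall i, i < m -> b i = a i.
  by have [b Pb ba] := aP m; exists b.
have /full_shift_cvg ba m i : i < m -> b m i = a i by apply: (bP m).2.
apply: clP => U /ba[N _ UN].
by exists (b N); split; [exact: (bP N).1|apply: UN => /=].
Qed.

(** Otherwise each [x] fails at some [f x], and an [x] that succeeds at the maximum of [f]
    contradicts antitonicity. *)
Lemma pigeonhole_antitone {T : finType} (Q : T -> nat -> Prop) :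
  (forall x m n, m <= n -> Q x n -> Q x m) ->
  (forall m, exists x, Q x m) -> exists x, forall m, Q x m.
Proof.
move=> Qanti Qex; apply: contrapT => /forallNP nQ.
have /choice[f nQf] x : exists m, ~ Q x m by apply/existsNP.
have [x Qx] := Qex (\max_x f x).
by apply: (nQf x); apply: Qanti Qx; apply: leq_bigmax.
Qed.

Section EdgeWalks.
Context {A : finType} {G : labeled_graph A}.

Definition is_walk (w : nat -> edge G) := forall n, target (w n) = source (w n.+1).

(** Starting edges replace starting vertices because intersecting with [prefix_set j] restricts the
    label of the first edge, which a set of vertices cannot express. *)
Definition walks_from (E : {set edge G}) : set (full_shift A) :=
  [set a | exists w, [/\ is_walk w, w 0 \in E & forall n, a n = label (w n)]].

Lemma path_set_of_walks_from (v : vertex G) :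
  path_set_of v = walks_from [set e | source e == v].
Proof.
apply/seteqP; split=> a.
  by move=> [w [w0 wP] aw]; exists w; split=> //; rewrite inE w0.
by move=> [w [wP]]; rewrite inE => /eqP w0 aw; exists w.
Qed.

Lemma shift_walks_from (E : {set edge G}) :
  @shift A @` walks_from E =
  walks_from [set f | [exists e in E, target e == source f]].
Proof.
apply/seteqP; split=> [_ [a [w [wP w0 aw]] <-]|a [w [wP]]].
  exists (fun n => w n.+1); split=> [n||n]; [exact: wP| |exact: aw].
  by rewrite inE; apply/existsP; exists (w 0); rewrite w0 wP eqxx.
rewrite inE => /existsP[e /andP[eE /eqP ew]] aw.
(* The edge [e] is put in front of the walk; its label is the letter that the shift drops. *)
pose w' n := if n is k.+1 then w k else e.
exists (fun n => label (w' n)); last by apply: funext => n; rewrite /shift /= aw.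
by exists w'; split=> // -[].
Qed.

Lemma walks_from_prefix (E : {set edge G}) (j : A) :
  walks_from E `&` prefix_set j = walks_from [set e in E | label e == j].
Proof.
apply/seteqP; split=> [a [[w [wP w0 aw]] aj]|a [w [wP]]].
  by exists w; split=> //; rewrite inE w0 -aw aj eqxx.
rewrite inE => /andP[w0 /eqP wj] aw.
by split; [exists w|rewrite /prefix_set /= aw].
Qed.

Definition traces (a : nat -> A) (m : nat) (w : nat -> edge G) :=
  is_walk w /\ forall i, i < m -> label (w i) = a i.

Lemma traces_le {a : nat -> A} {m n : nat} {w : nat -> edge G} :
  m <= n -> traces a n w -> traces a m w.
Proof.
by move=> mn [wP wa]; split=> // i im; apply: wa; apply: leq_trans mn.
Qed.

Lemma traces_behead {a : nat -> A} {m : nat} {w : nat -> edge G} :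
  traces a m.+1 w -> traces (fun i => a i.+1) m (fun i => w i.+1).
Proof. by move=> [wP wa]; split=> // i im; apply: wa. Qed.

(** The walk may change with [m]; [extendible_walk] replaces these walks by a single one, as in
    König's lemma. *)
Definition extendible (a : nat -> A) (e : edge G) :=
  forall m, exists2 w, w 0 = e & traces a m w.

(** Tracing [m] letters is antitone in [m], so by pigeonhole one of the finitely many edges of [E]
    serves every [m]. *)
Lemma extendible_pick (a : nat -> A) (E : {set edge G}) :
  (forall m, exists2 w, w 0 \in E & traces a m w) ->
  exists2 e, e \in E & extendible a e.
Proof.
move=> Ea.
have [||e eP] := @pigeonhole_antitone (edge G)
    (fun e m => e \in E /\ exists2 w, w 0 = e & traces a m w).
- by move=> e m n mn [eE [w we wa]]; split=> //; exists w => //; apply: traces_le wa.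
- by move=> m; have [w wE wa] := Ea m; exists (w 0); split=> //; exists w.
- by exists e; [exact: (eP 0).1|move=> m; exact: (eP m).2].
Qed.

Lemma extendible_step (a : nat -> A) (e : edge G) : extendible a e ->
  exists2 f, source f = target e & extendible (fun i => a i.+1) f.
Proof.
move=> ea.
have [m|f] := extendible_pick (fun i => a i.+1) [set f | source f == target e].
  have [w we wa] := ea m.+1.
  exists (fun i => w i.+1); last exact: traces_behead.
  by rewrite inE -we (wa.1 0).
by rewrite inE => /eqP; exists f.
Qed.

Lemma extendible_walk (a : nat -> A) (e : edge G) : extendible a e ->
  exists w, [/\ is_walk w, w 0 = e & forall n, label (w n) = a n].
Proof.
move=> ea; pose suffix n := fun i => a (n + i).
(* A state pairs an edge with the number of letters read before it. The existential precedes the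
   hypothesis so that [choice] yields a total function; at a state that is not extendible the edge
   itself is a default value. *)
have step p : exists f, extendible (suffix p.2) p.1 ->
    source f = target p.1 /\ extendible (suffix p.2.+1) f.
  have [/extendible_step[f fe fa]|np] := pselect (extendible (suffix p.2) p.1).
    exists f => _; split=> //.
    by rewrite /suffix; under eq_fun do rewrite addSnnS.
  by exists p.1 => /np.
have [next nextP] := choice step.
pose w := fix w n := if n is k.+1 then next (w k, k) else e.
have wa n : extendible (suffix n) (w n).
  by elim: n => [|n IH]; [exact: ea|exact: (nextP (w n, n) IH).2].
exists w; split=> // n; first exact/esym/((nextP (w n, n) (wa n)).1).
by have [u <- [_ /(_ 0 isT) ->]] := wa n 1; rewrite /suffix addn0.
Qed.

Lemma closed_walks_from (E : {set edge G}) : closed (walks_from E).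
Proof.
apply/closed_cylinderP => a aE.
have [m|e eE /extendible_walk[w [wP we wa]]] := extendible_pick a E.
  have [b [w [wP wE bw]] ba] := aE m.
  by exists w => //; split=> // i im; rewrite -bw ba.
by exists w; split=> //; rewrite we.
Qed.

End EdgeWalks.

Section FollowerSets.
Context {A : finType}.
Implicit Types (X : set (full_shift A)) (a b c : full_shift A).

Definition follower X (j : A) := @shift A @` (X `&` prefix_set j).

Fixpoint followers X a n :=
  if n is k.+1 then follower (followers X a k) (a k) else X.

Lemma followersP X a n b :
  followers X a n b <->
  exists c, [/\ X c, forall i, i < n -> c i = a i & forall i, c (n + i) = b i].
Proof.
elim: n b => [|n IH] b /=.
  split=> [Xb|[c [Xc _ cb]]]; first by exists b.
  by have <- : c = b by apply: funext.
split=> [[d [/IH[c [Xc ca cd]] da] <-]|[c [Xc ca cb]]].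
  exists c; split=> // i; last by rewrite addSnnS cd.
  by rewrite ltnS leq_eqVlt => /predU1P[->|/ca//]; rewrite -[n]addn0 cd da addn0.
exists (fun i => c (n + i)); last by apply: funext => i; rewrite /shift -addSnnS.
split; last by rewrite /prefix_set /= addn0 ca.
by apply/IH; exists c; split=> // i im; apply: ca; apply: ltnW.
Qed.

Section FollowerGraph.
Variable s : seq {classic set (full_shift A)}.

(** The classical structure on sets makes [seq_sub s] a finite type, fit to be the vertex type. A
    nonempty target keeps walks out of the empty set, where every letter could be read forever. *)
Definition follower_edge (t : seq_sub s * seq_sub s * A) : bool :=
  `[< ssval t.1.2 = follower (ssval t.1.1) t.2 /\ ssval t.1.2 !=set0 >].

Lemma follower_edge_inj :
  injective (fun e : {t | follower_edge t} =>
    ((val e).1.1, (val e).1.2, (val e).2)).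
Proof.
move=> [[[x y] j] xyj] [[[x' y'] j'] xyj'] /= [ex ey ej]; apply: val_inj => /=.
by rewrite ex ey ej.
Qed.

Definition follower_graph : labeled_graph A :=
  @LabeledGraph A (seq_sub s) {t | follower_edge t} (fun e => (val e).1.1)
    (fun e => (val e).1.2) (fun e => (val e).2) follower_edge_inj.

Lemma follower_graph_edge (e : edge follower_graph) :
  ssval (target e) = follower (ssval (source e)) (label e) /\
  ssval (target e) !=set0.
Proof. exact/asboolP/(valP e). Qed.

Lemma path_set_of_follower_graph (v : vertex follower_graph) :
  closed (ssval v) -> (forall X j, X \in s -> follower X j \in s) ->
  ssval v = path_set_of v.
Proof.
move=> /closed_cylinderP clv sP; apply/seteqP; split=> a.
  move=> va.
  have in_s n : followers (ssval v) a n \in s.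
    by elim: n => [|n IH] /=; [exact: ssvalP|exact: sP].
  have ne n : followers (ssval v) a n !=set0.
    by exists (fun i => a (n + i)); apply/followersP; exists a.
  have eP n : follower_edge (SeqSub (in_s n), SeqSub (in_s n.+1), a n).
    by apply/asboolP; split=> //; exact: (ne n.+1).
  exists (fun n => Sub _ (eP n) : edge follower_graph) => //.
  by split=> //; apply: val_inj.
move=> [w [w0 wP] aw]; apply: clv => m.
have src n : ssval (source (w n)) = followers (ssval v) a n.
  elim: n => [|n IH]; first by rewrite w0.
  by rewrite -wP (follower_graph_edge _).1 IH /= aw.
(* The target of edge [m] is the follower set after [m.+1] letters; a point of it gives a point of
   [ssval v] agreeing with [a] on one letter more than required. *)
have [b] := (follower_graph_edge (w m)).2.
rewrite wP src => /followersP[c [vc ca _]].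
by exists c => // i im; apply: ca; apply: ltnW.
Qed.

End FollowerGraph.
End FollowerSets.

Theorem theorem1p9 (A : finType) (P : set (full_shift A)) :
  is_path_set P <->
  (closed P /\
   exists S0 : set (set (full_shift A)),
     [/\ finite_set S0,
         S0 P,
         (forall X : set (full_shift A), S0 X -> S0 (@shift A @` X)) &
         (forall (X : set (full_shift A)) (j : A),
            S0 X -> S0 (X `&` prefix_set j))]).
Proof.
split=> [[G [v ->]]|[clP [S0 [finS0 S0P S0shift S0prefix]]]].
  rewrite path_set_of_walks_from; split; first exact: closed_walks_from.
  (* There are finitely many sets of starting edges, and both operations only replace one such set
     by another. *)
  exists (range (@walks_from A G)); split.
  - exact/finite_image/finite_finset.
  - by eexists.
  - by move=> _ [E _ <-]; rewrite shift_walks_from; eexists.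
  - by move=> _ j [E _ <-]; rewrite walks_from_prefix; eexists.
have [s sE] := (@finite_seqP {classic set (full_shift A)} S0).1 finS0.
have Ps : (P : {classic set (full_shift A)}) \in s by move: S0P; rewrite sE.
exists (follower_graph s), (SeqSub Ps : vertex (follower_graph s)).
apply: (path_set_of_follower_graph s (SeqSub Ps)) => // X j Xs.
have : S0 (follower X j) by apply/S0shift/S0prefix; rewrite sE.
by rewrite sE.
Qed.
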